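(* Every interior angle $a_i$ of an efficient pentagon satisfies $80.91^\circ < a_i < 142.29^\circ$.
   Context: A unit-area pentagon is efficient if its perimeter is less than or equal to that of a unit-area Cairo pentagon, namely $2\sqrt{2+\sqrt3}\approx 3.8637$. (A Cairo pentagon has three angles of $2\pi/3$ and two nonadjacent right angles and is circumscribed about a circle.) *)

(* Defs.v *)
From Stdlib Require Import Reals.
Open Scope R_scope.

Definition point : Type := (R * R)%type.

Definition vsub (p q : point) : point := (fst p - fst q, snd p - snd q).
Definition dot (u v : point) : R := fst u * fst v + snd u * snd v.
Definition cross (u v : point) : R := fst u * snd v - snd u * fst v.
Definition norm (u : point) : R := sqrt (dot u u).
Definition point_dist (p q : point) : R := norm (vsub q p).

Definition on_segment (p q x : point) : Prop :=
  exists t : R, 0 <= t <= 1 /\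
    x = ((1 - t) * fst p + t * fst q, (1 - t) * snd p + t * snd q).

(* A closed pentagonal chain is given by its vertices P 0, ..., P 4 in cyclic
   order; the values of P at indices 5, 6, ... are never used. *)
Definition next (i : nat) : nat := Nat.modulo (i + 1) 5.
Definition prev (i : nat) : nat := Nat.modulo (i + 4) 5.

(* Side i joins P i to P (next i). Sides meet only at common endpoints (a simple
   pentagon); convexity is not required, and an angle equal to PI is allowed. *)
Definition pentagon (P : nat -> point) : Prop :=
  (forall i, (i < 5)%nat -> P i <> P (next i)) /\
  (forall i j x, (i < 5)%nat -> (j < 5)%nat -> i <> j ->
     on_segment (P i) (P (next i)) x -> on_segment (P j) (P (next j)) x ->
     (j = next i /\ x = P j) \/ (i = next j /\ x = P i)).

Definition perimeter (P : nat -> point) : R :=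
  sum_f_R0 (fun i => point_dist (P i) (P (next i))) 4.

(* Shoelace formula: positive iff the boundary is traversed counterclockwise. *)
Definition signed_area (P : nat -> point) : R :=
  / 2 * sum_f_R0 (fun i => cross (P i) (P (next i))) 4.

Definition area (P : nat -> point) : R := Rabs (signed_area P).

(* The counterclockwise angle in [0, 2 PI) from the nonzero vector u to the
   nonzero vector v. *)
Definition ccw_angle (u v : point) : R :=
  let t := acos (dot u v / (norm u * norm v)) in
  if Rle_dec 0 (cross u v) then t else 2 * PI - t.

(* In radians. The interior lies to the left of the boundary when the latter is
   traversed counterclockwise, and to the right otherwise, so a reflex angle is
   measured as a number greater than PI. *)
Definition interior_angle (P : nat -> point) (i : nat) : R :=
  let u := vsub (P (next i)) (P i) in
  let v := vsub (P (prev i)) (P i) in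
  if Rlt_dec 0 (signed_area P) then ccw_angle u v else ccw_angle v u.

Definition tangent_to_side (c : point) (r : R) (p q : point) : Prop :=
  exists x : point,
    on_segment p q x /\ point_dist c x = r /\ dot (vsub x c) (vsub q p) = 0.

Definition circumscribed (P : nat -> point) : Prop :=
  exists (c : point) (r : R), 0 < r /\
    forall i, (i < 5)%nat -> tangent_to_side c r (P i) (P (next i)).

Definition cairo (P : nat -> point) : Prop :=
  pentagon P /\ circumscribed P /\
  exists j k : nat, (j < 5)%nat /\ (k < 5)%nat /\
    j <> k /\ k <> next j /\ j <> next k /\
    interior_angle P j = PI / 2 /\ interior_angle P k = PI / 2 /\
    forall i, (i < 5)%nat -> i <> j -> i <> k ->
      interior_angle P i = 2 * PI / 3.

(* All Cairo pentagons of unit area are congruent, with perimeter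
   2 * sqrt (2 + sqrt 3), so the choice of C is immaterial. *)
Definition efficient (P : nat -> point) : Prop :=
  pentagon P /\ area P = 1 /\
  exists C : nat -> point,
    cairo C /\ area C = 1 /\ perimeter P <= perimeter C.

Definition degrees (x : R) : R := x * (PI / 180).

(* Main.v *)
Require Import Defs.
From Stdlib Require Import Reals Factorial Lra Lia.
Open Scope R_scope.

(* Mirroring if necessary, let the signed area be positive. A reflex or straight
   vertex can be deleted, leaving a closed quadrilateral of no smaller signed area,
   for which [L^2 >= 16 A]; this exceeds the Cairo value [4 (2 + sqrt 3)]. Otherwise
   all corners turn left, and a simple pentagon of this kind has total turning [2 PI].
   Lindeloef's inequality [L^2 >= 4 A (tan (t0 / 2) + ... + tan (t4 / 2))], with [ti]
   the exterior angles, is obtained by comparing with a circle tangent to three sides,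
   two of them adjacent and the third opposite to their common vertex. Convexity of
   [tan], with one angle prescribed, then excludes angles outside the stated range. *)

(** * Estimates for the tangent *)

(** Partial sums of the alternating series for [PI / 4 = 2 arctan (1/3) + arctan (1/7)]: eight terms
    bound it from below, seven from above. *)
Lemma PI_bounds : 3141592 / 1000000 < PI < 3141593 / 1000000.
Proof.
  generalize (PI_2_3_7_ineq 3).
  cbv [Nat.mul Nat.add sum_f_R0 tg_alt PI_2_3_7_tg Ratan_seq INR pow].
  lra.
Qed.

(** Convexity of [tan]: by the mean value theorem, since the derivative [1 + tan^2] increases on
    [(0, PI / 2)]. *)
Lemma tan_tangent_line (x y : R) :
  0 < x < PI / 2 -> 0 < y < PI / 2 ->
  tan y + (1 + (tan y)^2) * (x - y) <= tan x.
Proof.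
  intros Hx Hy.
  assert (D : forall z, 0 < z < PI / 2 ->
            derivable_pt_lim tan z (1 + (tan z)^2)).
  { intros z Hz.
    assert (Pr : - PI / 2 < z < PI / 2) by lra.
    rewrite <- (derive_pt_tan z Pr).
    destruct (derivable_pt_tan z Pr) as [l Hl]; exact Hl. }
  destruct (Rtotal_order x y) as [H | [-> | H]].
  - destruct (MVT_cor2 tan (fun z => 1 + (tan z)^2) x y H) as (c & E & Hc).
    { intros c Hc; apply D; lra. }
    assert (0 < tan c) by (apply tan_gt_0; lra).
    assert (tan c < tan y) by (apply tan_increasing; lra).
    assert (0 < (tan y)^2 - (tan c)^2) by nra.
    nra.
  - lra.
  - destruct (MVT_cor2 tan (fun z => 1 + (tan z)^2) y x H) as (c & E & Hc).
    { intros c Hc; apply D; lra. }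
    assert (0 < tan y) by (apply tan_gt_0; lra).
    assert (tan y < tan c) by (apply tan_increasing; lra).
    assert (0 < (tan c)^2 - (tan y)^2) by nra.
    nra.
Qed.

(** A lower Taylor polynomial of [sin] over an upper one of [cos]. At a rational point the bound is
    a rational number, which [lra] can evaluate. *)
Lemma tan_ge_taylor (x : R) :
  0 < x < 1 ->
  (x - x^3 / 6 + x^5 / 120 - x^7 / 5040)
    / (1 - x^2 / 2 + x^4 / 24 - x^6 / 720 + x^8 / 40320) <= tan x.
Proof.
  intros Hx.
  pose proof PI_bounds as HPI.
  destruct (sin_bound x 1) as [Hs _]; [lra | lra |].
  destruct (cos_bound x 1) as [_ Hc]; [lra | lra |].
  assert (Hc0 : 0 < cos x) by (apply cos_gt_0; lra).
  assert (Hs' : x - x^3 / 6 + x^5 / 120 - x^7 / 5040 <= sin x).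
  { eapply Rle_trans; [right | exact Hs].
    cbv [sin_approx sin_term sum_f_R0 Nat.mul Nat.add].
    replace (INR (fact 1)) with 1 by (simpl; lra).
    replace (INR (fact 3)) with 6 by (simpl; lra).
    replace (INR (fact 5)) with 120 by (simpl; lra).
    replace (INR (fact 7)) with 5040 by (rewrite INR_IZR_INZ; reflexivity).
    field. }
  assert (Hc' : cos x <= 1 - x^2 / 2 + x^4 / 24 - x^6 / 720 + x^8 / 40320).
  { eapply Rle_trans; [exact Hc | right].
    cbv [cos_approx cos_term sum_f_R0 Nat.mul Nat.add].
    replace (INR (fact 0)) with 1 by (simpl; lra).
    replace (INR (fact 2)) with 2 by (simpl; lra).
    replace (INR (fact 4)) with 24 by (simpl; lra).
    replace (INR (fact 6)) with 720 by (rewrite INR_IZR_INZ; reflexivity).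
    replace (INR (fact 8)) with 40320 by (rewrite INR_IZR_INZ; reflexivity).
    field. }
  assert (H0 : 0 <= x - x^3 / 6 + x^5 / 120 - x^7 / 5040).
  { assert (0 < x^5) by (apply pow_lt; lra).
    replace (x^3) with (x * (x * x)) by ring.
    replace (x^7) with (x^5 * (x * x)) by ring.
    nra. }
  unfold tan, Rdiv.
  apply Rmult_le_compat; [exact H0 | | exact Hs' | apply Rinv_le_contravar; assumption].
  left; apply Rinv_0_lt_compat; lra.
Qed.

Lemma cairo_value_lt : 2 + sqrt 3 < 3732051 / 1000000.
Proof.
  assert (0 <= sqrt 3) by apply sqrt_pos.
  assert (sqrt 3 * sqrt 3 = 3) by (apply sqrt_sqrt; lra).
  nra.
Qed.

(* Jensen's inequality for the convex function [tan], in tangent line form: the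
   points of tangency are close to the values [x0 = (180 - 80.91) / 2] degrees,
   respectively [(180 - 142.29) / 2] degrees, and [(PI - x0) / 4] of the extremal
   pentagons. *)
Lemma tan_sum_bound (x0 x1 x2 x3 x4 : R) :
  0 < x0 < PI / 2 -> 0 < x1 < PI / 2 -> 0 < x2 < PI / 2 ->
  0 < x3 < PI / 2 -> 0 < x4 < PI / 2 ->
  x0 + x1 + x2 + x3 + x4 = PI ->
  86472 / 100000 <= x0 \/ x0 <= 32909 / 100000 ->
  2 + sqrt 3 < tan x0 + tan x1 + tan x2 + tan x3 + tan x4.
Proof.
  intros H0 H1 H2 H3 H4 HS HC.
  pose proof PI_bounds as HPI.
  pose proof cairo_value_lt as HV.
  (* Take the tangent line at [p] for [x0] and at [q] for the other four. What the tangent lines add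
     to [tan p + 4 * tan q] is [(tan p ^ 2 - tan q ^ 2) (x0 - p) + (1 + tan q ^ 2) (PI - p - 4 q)],
     and both terms are nonnegative. *)
  assert (G : forall p q, 0 < p < PI / 2 -> 0 < q < PI / 2 ->
     p + 4 * q <= PI ->
     (q <= p <= x0 \/ x0 <= p <= q) ->
     tan p + 4 * tan q <= tan x0 + tan x1 + tan x2 + tan x3 + tan x4).
  { intros p q Hp Hq Hpq Hx.
    pose proof (tan_tangent_line x0 p H0 Hp).
    pose proof (tan_tangent_line x1 q H1 Hq).
    pose proof (tan_tangent_line x2 q H2 Hq).
    pose proof (tan_tangent_line x3 q H3 Hq).
    pose proof (tan_tangent_line x4 q H4 Hq).
    assert (0 < tan p) by (apply tan_gt_0; lra).
    assert (0 < tan q) by (apply tan_gt_0; lra).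
    assert (HM : forall y z, 0 < y < PI / 2 -> 0 < z < PI / 2 -> y <= z ->
               (tan y)^2 <= (tan z)^2).
    { intros y z Hy Hz [Hyz | ->]; [|lra].
      apply pow_incr; split; [left; apply tan_gt_0; lra |].
      left; apply tan_increasing; lra. }
    assert (0 <= ((tan p)^2 - (tan q)^2) * (x0 - p)).
    { destruct Hx as [[Hx Hx'] | [Hx' Hx]].
      - pose proof (HM q p Hq Hp Hx); apply Rmult_le_pos; lra.
      - pose proof (HM p q Hp Hq Hx).
        replace (((tan p)^2 - (tan q)^2) * (x0 - p))
          with (((tan q)^2 - (tan p)^2) * (p - x0)) by ring.
        apply Rmult_le_pos; lra. }
    assert (0 <= (1 + (tan q)^2) * (PI - p - 4 * q)).
    { apply Rmult_le_pos; [pose proof (pow2_ge_0 (tan q)) |]; lra. }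
    assert ((1 + (tan q)^2) * (x1 + x2 + x3 + x4 - 4 * q)
            = (1 + (tan q)^2) * (PI - x0 - 4 * q)) by (f_equal; lra).
    lra. }
  (* In both cases [q] is [(PI - p) / 4] rounded down, so that [p + 4 * q <= PI] follows from
     [PI_bounds]. *)
  destruct HC as [HC | HC].
  - pose proof (G (86472 / 100000) (569217 / 1000000)) as G1.
    pose proof (tan_ge_taylor (86472 / 100000)) as T1.
    pose proof (tan_ge_taylor (569217 / 1000000)) as T2.
    lra.
  - pose proof (G (32909 / 100000) (703125 / 1000000)) as G1.
    pose proof (tan_ge_taylor (32909 / 100000)) as T1.
    pose proof (tan_ge_taylor (703125 / 1000000)) as T2.
    lra.
Qed.

(** * Quadrilaterals and reflex vertices *)

Lemma le_of_sq_le (a b : R) : 0 <= b -> a^2 <= b^2 -> a <= b.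
Proof.
  intros Hb H; destruct (Rle_lt_dec a b); nra.
Qed.

Lemma norm_sq (u : point) : norm u * norm u = dot u u.
Proof.
  apply sqrt_sqrt; unfold dot; nra.
Qed.

Lemma norm_ge0 (u : point) : 0 <= norm u.
Proof.
  apply sqrt_pos.
Qed.

Lemma dot_cross_sq (u v : point) :
  (dot u v)^2 + (cross u v)^2 = (norm u * norm v)^2.
Proof.
  replace ((norm u * norm v)^2) with ((norm u * norm u) * (norm v * norm v)) by ring.
  rewrite !norm_sq; unfold dot, cross; ring.
Qed.

Lemma dot_le_norm (u v : point) : dot u v <= norm u * norm v.
Proof.
  apply le_of_sq_le.
  - apply Rmult_le_pos; apply norm_ge0.
  - pose proof (dot_cross_sq u v); nra.
Qed.

Lemma cross_le_norm (u v : point) : cross u v <= norm u * norm v.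
Proof.
  apply le_of_sq_le.
  - apply Rmult_le_pos; apply norm_ge0.
  - pose proof (dot_cross_sq u v); nra.
Qed.

Lemma point_dist_triangle (p q r : point) :
  point_dist p r <= point_dist p q + point_dist q r.
Proof.
  unfold point_dist.
  set (u := vsub q p); set (v := vsub r q); set (w := vsub r p).
  pose proof (norm_ge0 u); pose proof (norm_ge0 v).
  apply le_of_sq_le; [lra |].
  pose proof (norm_sq u); pose proof (norm_sq v); pose proof (norm_sq w).
  pose proof (dot_le_norm u v).
  assert (dot w w = dot u u + dot v v + 2 * dot u v)
    by (unfold u, v, w, dot, vsub; simpl; ring).
  nra.
Qed.

Lemma norm_pos_of_cross (u v : point) : 0 < cross u v -> 0 < norm u /\ 0 < norm v.
Proof.
  intros H; pose proof (cross_le_norm u v).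
  pose proof (norm_ge0 u); pose proof (norm_ge0 v).
  split; nra.
Qed.

Definition length5 (p0 p1 p2 p3 p4 : point) : R :=
  point_dist p0 p1 + point_dist p1 p2 + point_dist p2 p3 + point_dist p3 p4
  + point_dist p4 p0.

(** Twice the signed area. *)
Definition shoelace5 (p0 p1 p2 p3 p4 : point) : R :=
  cross p0 p1 + cross p1 p2 + cross p2 p3 + cross p3 p4 + cross p4 p0.

(** Twice the signed area of the triangle [p q r], hence invariant under cyclic permutation;
    positive at a left turn. *)
Definition turn (p q r : point) : R := cross (vsub q p) (vsub r q).

(* Pairing the four corners in the two possible ways and averaging gives
   [4 A <= (a + c) (b + d)] for a closed quadrilateral with sides [a, b, c, d]. *)
Lemma quadrilateral_isoperimetric (p0 p1 p2 p3 : point) :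
  8 * (cross p0 p1 + cross p1 p2 + cross p2 p3 + cross p3 p0)
  <= (point_dist p0 p1 + point_dist p1 p2 + point_dist p2 p3 + point_dist p3 p0)^2.
Proof.
  unfold point_dist.
  set (e0 := vsub p1 p0); set (e1 := vsub p2 p1);
  set (e2 := vsub p3 p2); set (e3 := vsub p0 p3).
  assert (cross p0 p1 + cross p1 p2 + cross p2 p3 + cross p3 p0
          = cross e0 e1 + cross e2 e3)
    by (unfold e0, e1, e2, e3, cross, vsub; simpl; ring).
  assert (cross p0 p1 + cross p1 p2 + cross p2 p3 + cross p3 p0
          = cross e1 e2 + cross e3 e0)
    by (unfold e0, e1, e2, e3, cross, vsub; simpl; ring).
  pose proof (cross_le_norm e0 e1); pose proof (cross_le_norm e1 e2).
  pose proof (cross_le_norm e2 e3); pose proof (cross_le_norm e3 e0).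
  (* The inequality of arithmetic and geometric means, [4 (a + c) (b + d) <= (a + b + c + d)^2]. *)
  pose proof (pow2_ge_0 (norm e0 + norm e2 - norm e1 - norm e3)).
  lra.
Qed.

(* Deleting a reflex vertex increases the area and decreases the perimeter. *)
Lemma reflex_isoperimetric (p0 p1 p2 p3 p4 : point) :
  turn p4 p0 p1 <= 0 ->
  8 * shoelace5 p0 p1 p2 p3 p4 <= (length5 p0 p1 p2 p3 p4)^2.
Proof.
  intros H.
  pose proof (quadrilateral_isoperimetric p1 p2 p3 p4) as Q.
  pose proof (point_dist_triangle p4 p0 p1) as T.
  assert (shoelace5 p0 p1 p2 p3 p4 = cross p1 p2 + cross p2 p3 + cross p3 p4
            + cross p4 p1 + turn p4 p0 p1)
    by (unfold shoelace5, turn, cross, vsub; simpl; ring).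
  apply Rle_trans
    with ((point_dist p1 p2 + point_dist p2 p3 + point_dist p3 p4 + point_dist p4 p1)^2);
    [lra |].
  apply pow_incr; unfold length5.
  assert (Hd : forall p q, 0 <= point_dist p q) by (intros; apply norm_ge0).
  pose proof (Hd p1 p2); pose proof (Hd p2 p3); pose proof (Hd p3 p4);
  pose proof (Hd p4 p1); lra.
Qed.

(** * Orientations of the triples of vertices *)

Definition disjoint_segments (a b c d : point) : Prop :=
  forall x, on_segment a b x -> on_segment c d x -> False.

(** Each segment has its end points on the two sides of the line through the other, one of them
    possibly on that line, so the segments meet. *)
Lemma segments_cross (a b c d : point) :
  disjoint_segments a b c d ->
  0 < turn a b c -> 0 < turn b c d -> turn a b d <= 0 -> turn c d a <= 0 -> False.
Proof.
  intros HD Hc Hb Hd Ha.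
  set (k := turn a b c - turn a b d).
  assert (Hk : 0 < k) by (unfold k; lra).
  assert (Ek : k = turn b c d - turn c d a)
    by (unfold k, turn, cross, vsub; simpl; ring).
  (* Along [a b] the function [turn c d] is affine, and it increases by [k] from [a] to [b]; the
     witness is its zero. Likewise [turn a b] decreases by [k] from [c] to [d], which gives the
     parameter on the other segment. *)
  apply (HD ((1 - (- turn c d a / k)) * fst a + (- turn c d a / k) * fst b,
             (1 - (- turn c d a / k)) * snd a + (- turn c d a / k) * snd b)).
  - exists (- turn c d a / k); split; [| reflexivity].
    split; apply Rmult_le_reg_r with k; try assumption; field_simplify; lra.
  - exists (turn a b c / k); split.
    + split; apply Rmult_le_reg_r with k; try assumption; field_simplify; try lra;
        unfold k; lra.
    + assert (E : cross (vsub b a) (vsub d c) <> 0).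
      { replace (cross (vsub b a) (vsub d c)) with (- k)
          by (unfold k, turn, cross, vsub; simpl; ring); lra. }
      assert (Ek' : k = - cross (vsub b a) (vsub d c))
        by (unfold k, turn, cross, vsub; simpl; ring).
      rewrite Ek'; unfold turn, cross, vsub in *; simpl in *.
      f_equal; field; intro; apply E; lra.
Qed.

(* The Grassmann-Pluecker relation among the five points. *)
Lemma turn_pluecker (p0 p1 p2 p3 p4 : point) :
  turn p0 p1 p3 * turn p4 p0 p2
  = turn p0 p1 p2 * turn p3 p4 p0 + turn p4 p0 p1 * turn p2 p3 p0.
Proof.
  unfold turn, cross, vsub; simpl; ring.
Qed.

(** All corners turn left. A pentagram has this property too; [simple5] is what excludes it. *)
Definition convex5 (p0 p1 p2 p3 p4 : point) : Prop :=
  0 < turn p4 p0 p1 /\ 0 < turn p0 p1 p2 /\ 0 < turn p1 p2 p3 /\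
  0 < turn p2 p3 p4 /\ 0 < turn p3 p4 p0.

Definition simple5 (p0 p1 p2 p3 p4 : point) : Prop :=
  disjoint_segments p0 p1 p2 p3 /\ disjoint_segments p1 p2 p3 p4 /\
  disjoint_segments p2 p3 p4 p0 /\ disjoint_segments p3 p4 p0 p1 /\
  disjoint_segments p4 p0 p1 p2.

(** If [turn p0 p1 p3] were nonpositive, [segments_cross] would make [turn p2 p3 p0] and
    [turn p3 p4 p1] positive. The Pluecker relation then makes [turn p4 p0 p2] nonpositive, so
    [turn p1 p2 p4] is positive, and a rotated Pluecker relation equates a nonpositive number with a
    positive one. *)
Lemma diagonal_turn_pos (p0 p1 p2 p3 p4 : point) :
  convex5 p0 p1 p2 p3 p4 -> simple5 p0 p1 p2 p3 p4 -> 0 < turn p0 p1 p3.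
Proof.
  intros (C4 & C0 & C1 & C2 & C3) (D0 & D1 & D2 & D3 & D4).
  destruct (Rle_lt_dec (turn p0 p1 p3) 0) as [H0 | H0]; [exfalso | exact H0].
  destruct (Rle_lt_dec (turn p2 p3 p0) 0) as [H2 | H2];
    [exact (segments_cross p0 p1 p2 p3 D0 C0 C1 H0 H2) |].
  destruct (Rle_lt_dec (turn p3 p4 p1) 0) as [H3 | H3];
    [exact (segments_cross p3 p4 p0 p1 D3 C3 C4 H3 H0) |].
  pose proof (turn_pluecker p0 p1 p2 p3 p4) as E0.
  assert (H4 : turn p4 p0 p2 <= 0) by nra.
  destruct (Rle_lt_dec (turn p1 p2 p4) 0) as [H1 | H1];
    [exact (segments_cross p4 p0 p1 p2 D4 C4 C0 H4 H1) |].
  pose proof (turn_pluecker p4 p0 p1 p2 p3) as E4.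
  nra.
Qed.

Lemma convex5_rot (p0 p1 p2 p3 p4 : point) :
  convex5 p0 p1 p2 p3 p4 -> convex5 p1 p2 p3 p4 p0.
Proof.
  unfold convex5; tauto.
Qed.

Lemma simple5_rot (p0 p1 p2 p3 p4 : point) :
  simple5 p0 p1 p2 p3 p4 -> simple5 p1 p2 p3 p4 p0.
Proof.
  unfold simple5; tauto.
Qed.

(** For consecutive vertices this has the sign of the sine of the sum of the exterior angles at [q]
    and [r]. With left turns at both, it is positive iff the sides [p q] and [r s], prolonged, meet
    beyond [q r]. *)
Definition skew_turn (p q r s : point) : R := cross (vsub q p) (vsub s r).

(** Otherwise [turn p0 p1 p3 <= turn p0 p1 p2] and [turn p4 p0 p2 <= turn p3 p4 p0]. But by the
    Pluecker relation the product of the two left sides exceeds that of the right sides by the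
    positive number [turn p4 p0 p1 * turn p2 p3 p0]. *)
Lemma skew_turn_pos (p0 p1 p2 p3 p4 : point) :
  convex5 p0 p1 p2 p3 p4 -> simple5 p0 p1 p2 p3 p4 ->
  0 < skew_turn p0 p1 p2 p3 \/ 0 < skew_turn p2 p3 p4 p0.
Proof.
  intros C S.
  pose proof (diagonal_turn_pos _ _ _ _ _ C S) as H0.
  pose proof (convex5_rot _ _ _ _ _ C) as C1; pose proof (simple5_rot _ _ _ _ _ S) as S1.
  pose proof (convex5_rot _ _ _ _ _ C1) as C2; pose proof (simple5_rot _ _ _ _ _ S1) as S2.
  pose proof (diagonal_turn_pos _ _ _ _ _ C2 S2) as H2.
  pose proof (turn_pluecker p0 p1 p2 p3 p4) as E.
  destruct C as (K4 & K0 & K1 & K2 & K3).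
  assert (E0 : turn p0 p1 p3 = turn p0 p1 p2 + skew_turn p0 p1 p2 p3)
    by (unfold skew_turn, turn, cross, vsub; simpl; ring).
  assert (E4 : turn p4 p0 p2 = turn p3 p4 p0 + skew_turn p2 p3 p4 p0)
    by (unfold skew_turn, turn, cross, vsub; simpl; ring).
  destruct (Rle_lt_dec (skew_turn p0 p1 p2 p3) 0) as [G0 | G0]; [right | left; exact G0].
  destruct (Rle_lt_dec (skew_turn p2 p3 p4 p0) 0) as [G2 | G2]; [exfalso | exact G2].
  assert (0 < turn p4 p0 p1 * turn p2 p3 p0) by (apply Rmult_lt_0_compat; assumption).
  assert (0 < turn p4 p0 p2) by nra.
  nra.
Qed.

(** * Lindeloef's inequality *)

(* Signed distance from the line [p q] to [c], positive on the left. *)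
Definition line_dist (c p q : point) : R :=
  cross (vsub q p) (vsub c p) / point_dist p q.

(** Cosecant and cotangent are expressed by lengths and products rather than through [acos], which
    keeps the identities below algebraic. *)
Definition ext_csc (p q r : point) : R :=
  point_dist p q * point_dist q r / turn p q r.
Definition ext_cot (p q r : point) : R :=
  dot (vsub q p) (vsub r q) / turn p q r.
(* With [a] the exterior angle at [q], [tan (a / 2) = 1 / sin a - cot a]. *)
Definition ext_half_tan (p q r : point) : R := ext_csc p q r - ext_cot p q r.

Lemma point_dist_pos_of_turn (p q r : point) :
  0 < turn p q r -> 0 < point_dist p q /\ 0 < point_dist q r.
Proof.
  apply norm_pos_of_cross.
Qed.

(** The left side is the abscissa, along [q r] and from [q], of the foot of the perpendicular from
    [c]. It is linear in the distances of [c] to the two lines through [q], as these determine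
    [c]. *)
Lemma foot_after_corner (p q r c : point) :
  0 < turn p q r ->
  dot (vsub r q) (vsub c q) / point_dist q r
  = line_dist c p q * ext_csc p q r - line_dist c q r * ext_cot p q r.
Proof.
  intros H; destruct (point_dist_pos_of_turn _ _ _ H) as [Hp Hq].
  unfold line_dist, ext_csc, ext_cot.
  assert (E : dot (vsub r q) (vsub c q) * turn p q r
    = cross (vsub q p) (vsub c p) * (point_dist q r * point_dist q r)
      - cross (vsub r q) (vsub c q) * dot (vsub q p) (vsub r q)).
  { unfold point_dist; rewrite norm_sq; unfold turn, dot, cross, vsub; simpl; ring. }
  apply Rmult_eq_reg_r with (point_dist q r * turn p q r).
  - field_simplify; [rewrite E; ring | lra | lra].
  - apply Rgt_not_eq, Rmult_lt_0_compat; assumption.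
Qed.

Lemma foot_before_corner (p q r c : point) :
  0 < turn p q r ->
  dot (vsub q p) (vsub c q) / point_dist p q
  = line_dist c p q * ext_cot p q r - line_dist c q r * ext_csc p q r.
Proof.
  intros H; destruct (point_dist_pos_of_turn _ _ _ H) as [Hp Hq].
  unfold line_dist, ext_csc, ext_cot.
  assert (E : dot (vsub q p) (vsub c q) * turn p q r
    = cross (vsub q p) (vsub c p) * dot (vsub q p) (vsub r q)
      - cross (vsub r q) (vsub c q) * (point_dist p q * point_dist p q)).
  { unfold point_dist; rewrite norm_sq; unfold turn, dot, cross, vsub; simpl; ring. }
  apply Rmult_eq_reg_r with (point_dist p q * turn p q r).
  - field_simplify; [rewrite E; ring | lra | lra].
  - apply Rgt_not_eq, Rmult_lt_0_compat; assumption.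
Qed.

(** The foot of the perpendicular from [c] splits the side into two signed pieces, computed from the
    corners at [p] and [q]. *)
Lemma side_length (o p q s c : point) :
  0 < turn o p q -> 0 < turn p q s ->
  point_dist p q
  = line_dist c o p * ext_csc o p q - line_dist c p q * ext_cot o p q
    + line_dist c q s * ext_csc p q s - line_dist c p q * ext_cot p q s.
Proof.
  intros Hp Hq.
  destruct (point_dist_pos_of_turn _ _ _ Hq) as [Hpq _].
  pose proof (foot_after_corner o p q c Hp) as Ep.
  pose proof (foot_before_corner p q s c Hq) as Eq.
  assert (E : point_dist p q = dot (vsub q p) (vsub c p) / point_dist p q
              - dot (vsub q p) (vsub c q) / point_dist p q).
  { apply Rmult_eq_reg_r with (point_dist p q); [| lra].
    field_simplify; [| lra].
    unfold point_dist; simpl; rewrite Rmult_1_r, norm_sq.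
    unfold dot, vsub; simpl; ring. }
  lra.
Qed.

(** The area is the sum of the signed triangles with apex [c] over the sides. *)
Lemma shoelace5_line_dist (p0 p1 p2 p3 p4 c : point) :
  convex5 p0 p1 p2 p3 p4 ->
  shoelace5 p0 p1 p2 p3 p4
  = point_dist p0 p1 * line_dist c p0 p1 + point_dist p1 p2 * line_dist c p1 p2
    + point_dist p2 p3 * line_dist c p2 p3 + point_dist p3 p4 * line_dist c p3 p4
    + point_dist p4 p0 * line_dist c p4 p0.
Proof.
  intros (C4 & C0 & C1 & C2 & C3).
  assert (E : forall p q r, 0 < turn p q r ->
    point_dist p q * line_dist c p q = cross (vsub q p) (vsub c p)).
  { intros p q r H; destruct (point_dist_pos_of_turn _ _ _ H).
    unfold line_dist; field; lra. }
  rewrite (E p0 p1 p2), (E p1 p2 p3), (E p2 p3 p4), (E p3 p4 p0), (E p4 p0 p1)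
    by assumption.
  unfold shoelace5, cross, vsub; simpl; ring.
Qed.

Definition half_tan_sum (p0 p1 p2 p3 p4 : point) : R :=
  ext_half_tan p4 p0 p1 + ext_half_tan p0 p1 p2 + ext_half_tan p1 p2 p3
  + ext_half_tan p2 p3 p4 + ext_half_tan p3 p4 p0.

(** The points [p0 - t n0 (p0 - p4) + t n4 (p1 - p0)] of the bisector at [p0] have distance [t k] to
    both adjacent sides. Equal distance to [p2 p3] is the linear equation [t d = m], and the sign
    hypotheses give [d > 0]. *)
Lemma tritangent_center (p0 p1 p2 p3 p4 : point) :
  convex5 p0 p1 p2 p3 p4 ->
  0 <= skew_turn p0 p1 p2 p3 -> 0 <= skew_turn p2 p3 p4 p0 ->
  exists (c : point) (r : R),
    line_dist c p4 p0 = r /\ line_dist c p0 p1 = r /\ line_dist c p2 p3 = r.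
Proof.
  intros (C4 & C0 & C1 & C2 & C3) G0 G2.
  destruct (point_dist_pos_of_turn _ _ _ C4) as [N4 N0].
  destruct (point_dist_pos_of_turn _ _ _ C2) as [N2 _].
  set (n4 := point_dist p4 p0) in *; set (n0 := point_dist p0 p1) in *;
  set (n2 := point_dist p2 p3) in *; set (k := turn p4 p0 p1) in *.
  set (g0 := skew_turn p0 p1 p2 p3) in *; set (g2 := skew_turn p2 p3 p4 p0) in *.
  set (d := n2 * k + n4 * g0 + n0 * g2).
  assert (Hd : 0 < d).
  { unfold d; assert (0 < n2 * k) by (apply Rmult_lt_0_compat; assumption).
    assert (0 <= n4 * g0) by (apply Rmult_le_pos; lra).
    assert (0 <= n0 * g2) by (apply Rmult_le_pos; lra). lra. }
  set (m := cross (vsub p3 p2) (vsub p0 p2)).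
  set (r := m * k / d).
  set (x := - n0 * m / d); set (y := n4 * m / d).
  exists (fst p0 + x * (fst p0 - fst p4) + y * (fst p1 - fst p0),
          snd p0 + x * (snd p0 - snd p4) + y * (snd p1 - snd p0)), r.
  unfold line_dist; fold n4 n0 n2.
  repeat split.
  - transitivity (y * k / n4);
      [f_equal; unfold k, turn, cross, vsub; simpl; ring |].
    unfold y, r; field; lra.
  - transitivity (- x * k / n0);
      [f_equal; unfold k, turn, cross, vsub; simpl; ring |].
    unfold x, r; field; lra.
  - transitivity ((m + x * g2 - y * g0) / n2);
      [f_equal; unfold m, g0, g2, skew_turn, cross, vsub; simpl; ring |].
    replace m with (m * d / d) at 1 by (field; lra).
    unfold x, y, r; apply Rmult_eq_reg_r with (n2 * d); [| nra].
    field_simplify; [unfold d; ring | lra | lra].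
Qed.

(* [ext_cot p q r + ext_cot q r s] has the sign of [sin (a + b)], with [a] and [b]
   the exterior angles at [q] and [r]. *)
Lemma ext_cot_add_ge0 (p q r s : point) :
  0 < turn p q r -> 0 < turn q r s -> 0 <= skew_turn p q r s ->
  0 <= ext_cot p q r + ext_cot q r s.
Proof.
  intros Hq Hr G.
  destruct (point_dist_pos_of_turn _ _ _ Hr) as [N _].
  unfold ext_cot.
  assert (E : dot (vsub q p) (vsub r q) * turn q r s
              + dot (vsub r q) (vsub s r) * turn p q r
              = skew_turn p q r s * (point_dist q r * point_dist q r)).
  { unfold point_dist; rewrite norm_sq.
    unfold skew_turn, turn, dot, cross, vsub; simpl; ring. }
  replace (dot (vsub q p) (vsub r q) / turn p q r
           + dot (vsub r q) (vsub s r) / turn q r s)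
    with (skew_turn p q r s * (point_dist q r * point_dist q r)
          * / (turn p q r * turn q r s))
    by (rewrite <- E; field; lra).
  apply Rmult_le_pos; [apply Rmult_le_pos; [exact G | nra] |].
  left; apply Rinv_0_lt_compat, Rmult_lt_0_compat; assumption.
Qed.

Lemma ext_half_tan_pos (p q r : point) : 0 < turn p q r -> 0 < ext_half_tan p q r.
Proof.
  intros H; destruct (point_dist_pos_of_turn _ _ _ H) as [Hp Hq].
  unfold ext_half_tan, ext_csc, ext_cot.
  replace (point_dist p q * point_dist q r / turn p q r
           - dot (vsub q p) (vsub r q) / turn p q r)
    with ((point_dist p q * point_dist q r - dot (vsub q p) (vsub r q))
          * / turn p q r) by (field; lra).
  apply Rmult_lt_0_compat; [| apply Rinv_0_lt_compat; assumption].
  pose proof (dot_cross_sq (vsub q p) (vsub r q)) as E.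
  fold (turn p q r) in E; fold (point_dist p q) in E; fold (point_dist q r) in E.
  assert (0 < point_dist p q * point_dist q r) by (apply Rmult_lt_0_compat; assumption).
  nra.
Qed.

(* Write [k] for the sum of the half-angle tangents, [S] for the shoelace sum, [ai] for
   the exterior angle at [pi], [r] for the radius of the tritangent circle, [r + x] and
   [r + y] for the distances of its centre to the two other sides. Then [L^2 - 2 k S] is
   [(L - 2 k r)^2 + 2 k (x^2 (cot a1 + cot a2) + y^2 (cot a3 + cot a4))]. *)
Lemma lindelof_tritangent (p0 p1 p2 p3 p4 : point) :
  convex5 p0 p1 p2 p3 p4 ->
  0 <= skew_turn p0 p1 p2 p3 -> 0 <= skew_turn p2 p3 p4 p0 ->
  2 * half_tan_sum p0 p1 p2 p3 p4 * shoelace5 p0 p1 p2 p3 p4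
  <= (length5 p0 p1 p2 p3 p4)^2.
Proof.
  intros C G0 G2.
  destruct (tritangent_center _ _ _ _ _ C G0 G2) as (c & r & R4 & R0 & R2).
  rewrite (shoelace5_line_dist _ _ _ _ _ c C).
  destruct C as (C4 & C0 & C1 & C2 & C3).
  pose proof (side_length p4 p0 p1 p2 c C4 C0) as S0.
  pose proof (side_length p0 p1 p2 p3 c C0 C1) as S1.
  pose proof (side_length p1 p2 p3 p4 c C1 C2) as S2.
  pose proof (side_length p2 p3 p4 p0 c C2 C3) as S3.
  pose proof (side_length p3 p4 p0 p1 c C3 C4) as S4.
  pose proof (ext_cot_add_ge0 _ _ _ _ C0 C1 G0) as K1.
  pose proof (ext_cot_add_ge0 _ _ _ _ C2 C3 G2) as K3.
  pose proof (ext_half_tan_pos _ _ _ C0); pose proof (ext_half_tan_pos _ _ _ C1).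
  pose proof (ext_half_tan_pos _ _ _ C2); pose proof (ext_half_tan_pos _ _ _ C3).
  pose proof (ext_half_tan_pos _ _ _ C4).
  set (k := half_tan_sum p0 p1 p2 p3 p4).
  assert (Hk : 0 < k) by (unfold k, half_tan_sum; lra).
  rewrite R4, R0, R2 in *.
  set (x := line_dist c p1 p2 - r); set (y := line_dist c p3 p4 - r).
  assert (Ex : line_dist c p1 p2 = r + x) by (unfold x; ring).
  assert (Ey : line_dist c p3 p4 = r + y) by (unfold y; ring).
  rewrite Ex, Ey in *; clearbody x y.
  set (q := x * x * (ext_cot p0 p1 p2 + ext_cot p1 p2 p3)
            + y * y * (ext_cot p2 p3 p4 + ext_cot p3 p4 p0)).
  assert (Hq : 0 <= q).
  { unfold q; apply Rplus_le_le_0_compat; apply Rmult_le_pos; nra. }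
  set (L := length5 p0 p1 p2 p3 p4).
  assert (ES : point_dist p0 p1 * r + point_dist p1 p2 * (r + x)
               + point_dist p2 p3 * r + point_dist p3 p4 * (r + y)
               + point_dist p4 p0 * r = 2 * r * L - 2 * r * r * k - q).
  { unfold q, L, length5, k, half_tan_sum, ext_half_tan.
    rewrite S0, S1, S2, S3, S4; ring. }
  rewrite ES.
  assert (0 <= 2 * k * q) by (apply Rmult_le_pos; lra).
  pose proof (pow2_ge_0 (L - 2 * k * r)).
  lra.
Qed.

Lemma length5_rot (p0 p1 p2 p3 p4 : point) :
  length5 p1 p2 p3 p4 p0 = length5 p0 p1 p2 p3 p4.
Proof.
  unfold length5; ring.
Qed.

Lemma shoelace5_rot (p0 p1 p2 p3 p4 : point) :
  shoelace5 p1 p2 p3 p4 p0 = shoelace5 p0 p1 p2 p3 p4.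
Proof.
  unfold shoelace5; ring.
Qed.

Lemma half_tan_sum_rot (p0 p1 p2 p3 p4 : point) :
  half_tan_sum p1 p2 p3 p4 p0 = half_tan_sum p0 p1 p2 p3 p4.
Proof.
  unfold half_tan_sum; ring.
Qed.

(** Arrange the five skew turns in a cycle by steps of two vertices. By [skew_turn_pos] no two
    neighbours are both negative; as five is odd, some two neighbours are both nonnegative, and
    [lindelof_tritangent] applies to the corresponding rotation. *)
Lemma lindelof (p0 p1 p2 p3 p4 : point) :
  convex5 p0 p1 p2 p3 p4 -> simple5 p0 p1 p2 p3 p4 ->
  2 * half_tan_sum p0 p1 p2 p3 p4 * shoelace5 p0 p1 p2 p3 p4
  <= (length5 p0 p1 p2 p3 p4)^2.
Proof.
  intros C0 S0.
  pose proof (convex5_rot _ _ _ _ _ C0) as C1; pose proof (simple5_rot _ _ _ _ _ S0) as S1.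
  pose proof (convex5_rot _ _ _ _ _ C1) as C2; pose proof (simple5_rot _ _ _ _ _ S1) as S2.
  pose proof (convex5_rot _ _ _ _ _ C2) as C3; pose proof (simple5_rot _ _ _ _ _ S2) as S3.
  pose proof (convex5_rot _ _ _ _ _ C3) as C4; pose proof (simple5_rot _ _ _ _ _ S3) as S4.
  pose proof (lindelof_tritangent _ _ _ _ _ C0) as L0.
  pose proof (lindelof_tritangent _ _ _ _ _ C1) as L1.
  pose proof (lindelof_tritangent _ _ _ _ _ C2) as L2.
  pose proof (lindelof_tritangent _ _ _ _ _ C3) as L3.
  pose proof (lindelof_tritangent _ _ _ _ _ C4) as L4.
  pose proof (skew_turn_pos _ _ _ _ _ C0 S0) as G0.
  pose proof (skew_turn_pos _ _ _ _ _ C1 S1) as G1.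
  pose proof (skew_turn_pos _ _ _ _ _ C2 S2) as G2.
  pose proof (skew_turn_pos _ _ _ _ _ C3 S3) as G3.
  pose proof (skew_turn_pos _ _ _ _ _ C4 S4) as G4.
  do 1 rewrite half_tan_sum_rot, shoelace5_rot, length5_rot in L1.
  do 2 rewrite half_tan_sum_rot, shoelace5_rot, length5_rot in L2.
  do 3 rewrite half_tan_sum_rot, shoelace5_rot, length5_rot in L3.
  do 4 rewrite half_tan_sum_rot, shoelace5_rot, length5_rot in L4.
  destruct (Rle_lt_dec 0 (skew_turn p0 p1 p2 p3)), (Rle_lt_dec 0 (skew_turn p1 p2 p3 p4)),
    (Rle_lt_dec 0 (skew_turn p2 p3 p4 p0)), (Rle_lt_dec 0 (skew_turn p3 p4 p0 p1)),
    (Rle_lt_dec 0 (skew_turn p4 p0 p1 p2)); auto; lra.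
Qed.

(** * Exterior angles *)

Definition ext_angle (p q r : point) : R :=
  acos (dot (vsub q p) (vsub r q) / (point_dist p q * point_dist q r)).

Lemma ext_angle_trig (p q r : point) :
  0 < turn p q r ->
  0 < ext_angle p q r < PI /\
  dot (vsub q p) (vsub r q) = point_dist p q * point_dist q r * cos (ext_angle p q r) /\
  turn p q r = point_dist p q * point_dist q r * sin (ext_angle p q r).
Proof.
  intros H; destruct (point_dist_pos_of_turn _ _ _ H) as [Hp Hq].
  set (n := point_dist p q * point_dist q r).
  assert (Hn : 0 < n) by (apply Rmult_lt_0_compat; assumption).
  set (x := dot (vsub q p) (vsub r q) / n).
  assert (Ed : dot (vsub q p) (vsub r q) = n * x) by (unfold x; field; lra).
  pose proof (dot_cross_sq (vsub q p) (vsub r q)) as E.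
  fold (turn p q r) in E; fold (point_dist p q) in E; fold (point_dist q r) in E.
  fold n in E; rewrite Ed in E.
  assert (Ht : 0 < (turn p q r)^2) by (apply pow_lt; exact H).
  assert (Hn2 : 0 < n^2) by (apply pow_lt; exact Hn).
  assert (Hx2 : x^2 < 1) by nra.
  assert (Hx : -1 < x < 1) by (split; nra).
  assert (Ea : ext_angle p q r = acos x) by reflexivity.
  rewrite Ea, cos_acos by lra.
  split; [apply acos_bound_lt; exact Hx | split; [exact Ed |]].
  rewrite sin_acos by lra.
  assert (Hs : 0 <= sqrt (1 - Rsqr x)) by apply sqrt_pos.
  assert (Es : sqrt (1 - Rsqr x) * sqrt (1 - Rsqr x) = 1 - Rsqr x)
    by (apply sqrt_sqrt; unfold Rsqr; nra).
  unfold Rsqr at 3 in Es.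
  apply Rsqr_inj; [lra | apply Rmult_le_pos; lra |].
  rewrite Rsqr_mult; unfold Rsqr at 3; rewrite Es; unfold Rsqr; nra.
Qed.

Lemma ext_half_tan_angle (p q r : point) :
  0 < turn p q r -> ext_half_tan p q r = tan (ext_angle p q r / 2).
Proof.
  intros H; destruct (point_dist_pos_of_turn _ _ _ H) as [Hp Hq].
  destruct (ext_angle_trig _ _ _ H) as (Ha & Ec & Es).
  unfold ext_half_tan, ext_csc, ext_cot; rewrite Ec, Es.
  set (a := ext_angle p q r) in *.
  assert (0 < sin (a / 2)) by (apply sin_gt_0; lra).
  assert (0 < cos (a / 2)) by (apply cos_gt_0; lra).
  replace a with (2 * (a / 2)) at 1 2 3 by field.
  rewrite sin_2a, cos_2a_sin; unfold tan; field; lra.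
Qed.

(** The direction of [v] is that of [u] rotated by [a]; the lengths are multiplied out to avoid
    division. *)
Definition rotated_by (a : R) (u v : point) : Prop :=
  norm u * fst v = norm v * (cos a * fst u - sin a * snd u) /\
  norm u * snd v = norm v * (sin a * fst u + cos a * snd u).

Lemma rotated_by_ext_angle (p q r : point) :
  0 < turn p q r -> rotated_by (ext_angle p q r) (vsub q p) (vsub r q).
Proof.
  intros H; destruct (point_dist_pos_of_turn _ _ _ H) as [Hp _].
  destruct (ext_angle_trig _ _ _ H) as (_ & Ec & Es).
  set (a := ext_angle p q r) in *; clearbody a.
  unfold turn, point_dist in *.
  set (u := vsub q p) in *; set (v := vsub r q) in *.
  pose proof (norm_sq u) as Eu.
  split; apply Rmult_eq_reg_l with (norm u); try lra.
  - transitivity (dot u v * fst u - cross u v * snd u);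
      [rewrite <- Rmult_assoc, Eu; unfold dot, cross; ring | rewrite Ec, Es; ring].
  - transitivity (cross u v * fst u + dot u v * snd u);
      [rewrite <- Rmult_assoc, Eu; unfold dot, cross; ring | rewrite Ec, Es; ring].
Qed.

Lemma rotated_by_trans (a b : R) (u v w : point) :
  0 < norm v -> rotated_by a u v -> rotated_by b v w -> rotated_by (a + b) u w.
Proof.
  intros Hv [U1 U2] [V1 V2].
  split; apply Rmult_eq_reg_l with (norm v); try lra; rewrite cos_plus, sin_plus.
  - transitivity (norm u * (norm v * fst w)); [ring |]; rewrite V1.
    transitivity (norm w * (cos b * (norm u * fst v) - sin b * (norm u * snd v)));
      [ring |]; rewrite U1, U2; ring.
  - transitivity (norm u * (norm v * snd w)); [ring |]; rewrite V2.
    transitivity (norm w * (sin b * (norm u * fst v) + cos b * (norm u * snd v)));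
      [ring |]; rewrite U1, U2; ring.
Qed.

Lemma rotated_by_cross (a : R) (u v : point) :
  0 < norm u -> rotated_by a u v -> cross u v = norm u * norm v * sin a.
Proof.
  intros Hu [E1 E2]; apply Rmult_eq_reg_l with (norm u); [| lra].
  transitivity (fst u * (norm u * snd v) - snd u * (norm u * fst v));
    [unfold cross; ring |].
  rewrite E1, E2; transitivity (dot u u * norm v * sin a);
    [unfold dot; ring | rewrite <- norm_sq; ring].
Qed.

Lemma rotated_by_self (a : R) (u : point) :
  0 < norm u -> rotated_by a u u -> cos a = 1.
Proof.
  intros Hu [E1 E2].
  assert (E : norm u * dot u u = norm u * dot u u * cos a).
  { transitivity (fst u * (norm u * fst u) + snd u * (norm u * snd u));
      [unfold dot; ring |].
    rewrite E1, E2 at 1; unfold dot; ring. }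
  assert (0 < norm u * dot u u)
    by (rewrite <- norm_sq; repeat apply Rmult_lt_0_compat; assumption).
  apply Rmult_eq_reg_l with (norm u * dot u u); lra.
Qed.

Lemma cos_eq_1_lt_5PI (a : R) :
  0 < a < 5 * PI -> cos a = 1 -> a = 2 * PI \/ a = 4 * PI.
Proof.
  intros Ha Hc; pose proof PI_RGT_0 as HPI.
  assert (Hs : sin a = 0) by (pose proof (sin2_cos2 a); unfold Rsqr in *; nra).
  destruct (sin_eq_0_0 a Hs) as [k Hk].
  assert (K : (0 < k < 5)%Z) by (split; apply lt_IZR; nra).
  assert (C3 : cos (3 * PI) = -1).
  { replace (3 * PI) with (PI + 2 * PI) by ring.
    rewrite cos_plus, cos_2PI, sin_2PI, cos_PI; ring. }
  pose proof cos_PI as C1.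
  assert (k = 1 \/ k = 2 \/ k = 3 \/ k = 4)%Z as [-> | [-> | [-> | ->]]] by lia.
  - replace a with PI in Hc by lra; lra.
  - left; exact Hk.
  - replace a with (3 * PI) in Hc by lra; lra.
  - right; exact Hk.
Qed.

(* The total turning is a multiple of [2 PI] below [5 PI]. If it were [4 PI], any two
   consecutive exterior angles would add up to more than [PI], contrary to
   [skew_turn_pos]. *)
Lemma ext_angle_sum (p0 p1 p2 p3 p4 : point) :
  convex5 p0 p1 p2 p3 p4 -> simple5 p0 p1 p2 p3 p4 ->
  ext_angle p4 p0 p1 + ext_angle p0 p1 p2 + ext_angle p1 p2 p3 + ext_angle p2 p3 p4
  + ext_angle p3 p4 p0 = 2 * PI.
Proof.
  intros C S; pose proof (skew_turn_pos _ _ _ _ _ C S) as G.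
  destruct C as (C4 & C0 & C1 & C2 & C3).
  destruct (point_dist_pos_of_turn _ _ _ C0) as [N0 N1].
  destruct (point_dist_pos_of_turn _ _ _ C2) as [N2 N3].
  destruct (point_dist_pos_of_turn _ _ _ C4) as [N4 _].
  destruct (ext_angle_trig _ _ _ C0) as (A0 & _).
  destruct (ext_angle_trig _ _ _ C1) as (A1 & _).
  destruct (ext_angle_trig _ _ _ C2) as (A2 & _).
  destruct (ext_angle_trig _ _ _ C3) as (A3 & _).
  destruct (ext_angle_trig _ _ _ C4) as (A4 & _).
  pose proof (rotated_by_ext_angle _ _ _ C0) as R0.
  pose proof (rotated_by_ext_angle _ _ _ C1) as R1.
  pose proof (rotated_by_ext_angle _ _ _ C2) as R2.
  pose proof (rotated_by_ext_angle _ _ _ C3) as R3.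
  pose proof (rotated_by_ext_angle _ _ _ C4) as R4.
  (* Going once around, the five rotations carry the side [p0 p1] to itself. *)
  pose proof (rotated_by_trans _ _ _ _ _ N1 R0 R1) as R01.
  pose proof (rotated_by_trans _ _ _ _ _ N3 R2 R3) as R23.
  pose proof (rotated_by_trans _ _ _ _ _ N2 R01 R23) as R0123.
  pose proof (rotated_by_self _ _ N0 (rotated_by_trans _ _ _ _ _ N4 R0123 R4)) as E.
  apply cos_eq_1_lt_5PI in E; [| lra].
  destruct E as [E | E]; [lra | exfalso].
  assert (L : forall a b u v, 0 < a < PI -> 0 < b < PI -> PI < a + b ->
            0 < norm u -> 0 < norm v -> rotated_by (a + b) u v -> cross u v < 0).
  { intros a b u v Ha Hb Hab Hu Hv HR.
    rewrite (rotated_by_cross _ _ _ Hu HR).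
    assert (sin (a + b) < 0) by (apply sin_lt_0; lra).
    assert (0 < norm u * norm v) by (apply Rmult_lt_0_compat; assumption).
    nra. }
  unfold skew_turn in G; destruct G as [G | G].
  - apply (L _ _ _ _ A0 A1) in R01; try assumption; lra.
  - apply (L _ _ _ _ A2 A3) in R23; try assumption; lra.
Qed.

Lemma ccw_angle_ext_angle (p q r : point) :
  0 < turn p q r -> ccw_angle (vsub r q) (vsub p q) = PI - ext_angle p q r.
Proof.
  intros H; destruct (point_dist_pos_of_turn _ _ _ H) as [Hp Hq].
  unfold ccw_angle, ext_angle.
  replace (cross (vsub r q) (vsub p q)) with (turn p q r)
    by (unfold turn, cross, vsub; simpl; ring).
  destruct (Rle_dec 0 (turn p q r)) as [_ | F]; [| lra].
  rewrite <- acos_opp; f_equal.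
  replace (norm (vsub p q)) with (point_dist p q)
    by (unfold point_dist, norm; f_equal; unfold dot, vsub; simpl; ring).
  change (norm (vsub r q)) with (point_dist q r).
  replace (dot (vsub r q) (vsub p q)) with (- dot (vsub q p) (vsub r q))
    by (unfold dot, vsub; simpl; ring).
  field; lra.
Qed.

Lemma efficient_corner_bounds (p0 p1 p2 p3 p4 : point) :
  simple5 p0 p1 p2 p3 p4 -> shoelace5 p0 p1 p2 p3 p4 = 2 ->
  (length5 p0 p1 p2 p3 p4)^2 <= 4 * (2 + sqrt 3) ->
  degrees 80.91 < ccw_angle (vsub p1 p0) (vsub p4 p0) < degrees 142.29.
Proof.
  intros S HA HL; pose proof cairo_value_lt as HV.
  (* A corner that does not turn left would give [16 <= L^2], while [4 * (2 + sqrt 3) < 15]. *)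
  assert (C : convex5 p0 p1 p2 p3 p4).
  { pose proof (reflex_isoperimetric p0 p1 p2 p3 p4) as Q0.
    pose proof (reflex_isoperimetric p1 p2 p3 p4 p0) as Q1.
    pose proof (reflex_isoperimetric p2 p3 p4 p0 p1) as Q2.
    pose proof (reflex_isoperimetric p3 p4 p0 p1 p2) as Q3.
    pose proof (reflex_isoperimetric p4 p0 p1 p2 p3) as Q4.
    do 1 rewrite shoelace5_rot, length5_rot in Q1.
    do 2 rewrite shoelace5_rot, length5_rot in Q2.
    do 3 rewrite shoelace5_rot, length5_rot in Q3.
    do 4 rewrite shoelace5_rot, length5_rot in Q4.
    repeat split; apply Rnot_le_lt; intros F;
      [apply Q0 in F | apply Q1 in F | apply Q2 in F | apply Q3 in F | apply Q4 in F];
      lra. }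
  pose proof (lindelof _ _ _ _ _ C S) as L; rewrite HA in L.
  pose proof (ext_angle_sum _ _ _ _ _ C S) as E.
  destruct C as (C4 & C0 & C1 & C2 & C3).
  unfold half_tan_sum in L.
  rewrite (ext_half_tan_angle _ _ _ C0), (ext_half_tan_angle _ _ _ C1),
    (ext_half_tan_angle _ _ _ C2), (ext_half_tan_angle _ _ _ C3),
    (ext_half_tan_angle _ _ _ C4) in L.
  rewrite (ccw_angle_ext_angle _ _ _ C4).
  destruct (ext_angle_trig _ _ _ C0) as (A0 & _).
  destruct (ext_angle_trig _ _ _ C1) as (A1 & _).
  destruct (ext_angle_trig _ _ _ C2) as (A2 & _).
  destruct (ext_angle_trig _ _ _ C3) as (A3 & _).
  destruct (ext_angle_trig _ _ _ C4) as (A4 & _).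
  pose proof (tan_sum_bound (ext_angle p4 p0 p1 / 2) (ext_angle p0 p1 p2 / 2)
    (ext_angle p1 p2 p3 / 2) (ext_angle p2 p3 p4 / 2) (ext_angle p3 p4 p0 / 2)) as T.
  pose proof PI_bounds as HPI; unfold degrees.
  (* The two thresholds for half the exterior angle are slightly stricter than 80.91 and 142.29
     degrees require, which leaves room for the rational bounds on [PI]. *)
  destruct (Rle_lt_dec (86472 / 100000) (ext_angle p4 p0 p1 / 2)) as [F | F1];
    [exfalso; lra |].
  destruct (Rle_lt_dec (ext_angle p4 p0 p1 / 2) (32909 / 100000)) as [F | F2];
    [exfalso; lra |].
  lra.
Qed.

(** * The Cairo pentagon *)

(** The point of contact is the foot of the perpendicular from [c]. It lies on the side, whence the
    signs of its abscissas from [p] and from [q]. *)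
Lemma tangent_to_side_spec (c p q : point) (r : R) :
  0 < point_dist p q -> tangent_to_side c r p q ->
  (line_dist c p q)^2 = r^2 /\
  0 <= dot (vsub q p) (vsub c p) / point_dist p q /\
  dot (vsub q p) (vsub c q) / point_dist p q <= 0.
Proof.
  intros Hd (x & (t & Ht & Ex) & Er & Ho).
  pose proof (norm_sq (vsub q p)) as En; fold (point_dist p q) in En.
  set (e := vsub q p) in *.
  assert (Hi : 0 < / point_dist p q) by (apply Rinv_0_lt_compat; exact Hd).
  assert (He : 0 < dot e e) by (rewrite <- En; apply Rmult_lt_0_compat; exact Hd).
  split; [| split].
  - unfold line_dist; fold e.
    assert (E1 : cross e (vsub c p) = - cross e (vsub x c))
      by (rewrite Ex; unfold e, cross, vsub; simpl; ring).
    pose proof (dot_cross_sq e (vsub x c)) as E2.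
    replace (dot e (vsub x c)) with 0 in E2 by (rewrite <- Ho; unfold dot; ring).
    change (norm (vsub x c)) with (point_dist c x) in E2.
    change (norm e) with (point_dist p q) in E2.
    rewrite E1, <- Er; apply Rmult_eq_reg_r with ((point_dist p q)^2);
      [field_simplify; lra | apply pow_nonzero; lra].
  - apply Rmult_le_pos; [| lra].
    replace (dot e (vsub c p)) with (t * dot e e - dot (vsub x c) e)
      by (rewrite Ex; unfold e, dot, vsub; simpl; ring).
    rewrite Ho; nra.
  - replace (dot e (vsub c q)) with (- ((1 - t) * dot e e) - dot (vsub x c) e)
      by (rewrite Ex; unfold e, dot, vsub; simpl; ring).
    rewrite Ho; unfold Rdiv.
    assert (0 <= (1 - t) * dot e e) by (apply Rmult_le_pos; lra).
    nra.
Qed.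

(** Both distances are [r] up to sign. If they were opposite, the feet on the two sides would have
    the same abscissa from [q], a nonzero multiple of [csc + cot > 0]; but one is at most 0 and the
    other at least 0. *)
Lemma circle_same_side (c p q s : point) (r : R) :
  0 < r -> 0 < turn p q s -> tangent_to_side c r p q -> tangent_to_side c r q s ->
  line_dist c p q = line_dist c q s.
Proof.
  intros Hr H T1 T2; destruct (point_dist_pos_of_turn _ _ _ H) as [Hp Hq].
  destruct (tangent_to_side_spec _ _ _ _ Hp T1) as (E1 & _ & F1).
  destruct (tangent_to_side_spec _ _ _ _ Hq T2) as (E2 & F2 & _).
  rewrite (foot_before_corner _ _ _ c H) in F1.
  rewrite (foot_after_corner _ _ _ c H) in F2.
  assert (K : 0 < ext_csc p q s + ext_cot p q s).
  { destruct (ext_angle_trig _ _ _ H) as (Ha & Ec & Es).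
    unfold ext_csc, ext_cot; rewrite Ec.
    replace (point_dist p q * point_dist q s / turn p q s
             + point_dist p q * point_dist q s * cos (ext_angle p q s) / turn p q s)
      with (point_dist p q * point_dist q s * (1 + cos (ext_angle p q s))
            * / turn p q s) by (field; lra).
    assert (-1 < cos (ext_angle p q s))
      by (rewrite <- cos_PI; apply cos_decreasing_1; lra).
    repeat apply Rmult_lt_0_compat; try lra.
    apply Rinv_0_lt_compat; exact H. }
  set (h := line_dist c p q) in *; set (h' := line_dist c q s) in *.
  assert (D : h = h' \/ h = - h').
  { assert ((h - h') * (h + h') = 0) as Z by (simpl in *; lra).
    apply Rmult_integral in Z; destruct Z; [left | right]; lra. }
  destruct D as [D | D]; [exact D | exfalso].
  rewrite D in F1, F2.
  assert (h' * (ext_csc p q s + ext_cot p q s) = 0) as Z by lra.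
  apply Rmult_integral in Z; destruct Z as [Z | Z]; [| lra].
  rewrite Z in E2; simpl in E2; nra.
Qed.

(** The equality case of [lindelof]: with a common distance [h] from [c] to the sides, the length is
    [2 h k] and the shoelace sum is [h] times the length. *)
Lemma circumscribed_length (p0 p1 p2 p3 p4 c : point) (r : R) :
  convex5 p0 p1 p2 p3 p4 -> 0 < r ->
  tangent_to_side c r p0 p1 -> tangent_to_side c r p1 p2 ->
  tangent_to_side c r p2 p3 -> tangent_to_side c r p3 p4 ->
  tangent_to_side c r p4 p0 ->
  (length5 p0 p1 p2 p3 p4)^2
  = 2 * half_tan_sum p0 p1 p2 p3 p4 * shoelace5 p0 p1 p2 p3 p4.
Proof.
  intros C Hr T0 T1 T2 T3 T4.
  rewrite (shoelace5_line_dist _ _ _ _ _ c C).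
  destruct C as (C4 & C0 & C1 & C2 & C3).
  pose proof (side_length p4 p0 p1 p2 c C4 C0) as S0.
  pose proof (side_length p0 p1 p2 p3 c C0 C1) as S1.
  pose proof (side_length p1 p2 p3 p4 c C1 C2) as S2.
  pose proof (side_length p2 p3 p4 p0 c C2 C3) as S3.
  pose proof (side_length p3 p4 p0 p1 c C3 C4) as S4.
  rewrite (circle_same_side _ _ _ _ _ Hr C0 T0 T1),
    (circle_same_side _ _ _ _ _ Hr C1 T1 T2),
    (circle_same_side _ _ _ _ _ Hr C2 T2 T3),
    (circle_same_side _ _ _ _ _ Hr C3 T3 T4) in *.
  set (h := line_dist c p4 p0) in *.
  set (L := length5 p0 p1 p2 p3 p4); set (k := half_tan_sum p0 p1 p2 p3 p4).
  assert (EL : L = 2 * h * k).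
  { unfold L, length5, k, half_tan_sum, ext_half_tan.
    rewrite S0, S1, S2, S3, S4; ring. }
  transitivity (2 * k * (L * h)); [rewrite EL; ring |].
  unfold L, length5; ring.
Qed.

Lemma turn_pos_of_ccw_angle (p q r : point) :
  q <> r -> p <> q -> 0 < ccw_angle (vsub r q) (vsub p q) < PI -> 0 < turn p q r.
Proof.
  assert (N : forall a b : point, a <> b -> 0 < norm (vsub a b)).
  { intros [a1 a2] [b1 b2] Hab; apply sqrt_lt_R0.
    unfold dot, vsub; simpl.
    apply Rnot_le_lt; intros F; apply Hab.
    assert (Z : forall x y, x * x + y * y <= 0 -> x = 0).
    { intros x y Hxy.
      pose proof (Rle_0_sqr x) as Hx; pose proof (Rle_0_sqr y) as Hy.
      unfold Rsqr in Hx, Hy; assert (E : x * x = 0) by lra.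
      apply Rmult_integral in E; tauto. }
    f_equal; apply Rminus_diag_uniq;
      [apply Z with (a2 - b2) | apply Z with (a1 - b1)]; lra. }
  intros Hqr Hpq H.
  assert (Hu : 0 < norm (vsub r q)) by (apply N; congruence).
  assert (Hv : 0 < norm (vsub p q)) by (apply N; exact Hpq).
  replace (turn p q r) with (cross (vsub r q) (vsub p q))
    by (unfold turn, cross, vsub; simpl; ring).
  set (u := vsub r q) in *; set (v := vsub p q) in *.
  unfold ccw_angle in H.
  assert (Hn : 0 < norm u * norm v) by (apply Rmult_lt_0_compat; assumption).
  (* A zero cross product would mean the angle 0 or [PI], a negative one an angle
     [2 * PI - t >= PI]. *)
  destruct (Rle_dec 0 (cross u v)) as [Hc | Hc].
  - destruct Hc as [Hc | Hc]; [exact Hc | exfalso].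
    pose proof (dot_cross_sq u v) as E; rewrite <- Hc in E.
    assert (Z : (dot u v - norm u * norm v) * (dot u v + norm u * norm v) = 0) by lra.
    apply Rmult_integral in Z; destruct Z as [Z | Z].
    + replace (dot u v) with (norm u * norm v) in H by lra.
      rewrite Rdiv_diag, acos_1 in H by lra; lra.
    + replace (dot u v) with (- (norm u * norm v)) in H by lra.
      rewrite Rdiv_opp_l, Rdiv_diag, acos_opp, acos_1 in H by lra; lra.
  - pose proof (acos_bound (dot u v / (norm u * norm v))); lra.
Qed.

Lemma perimeter_length5 (P : nat -> point) :
  perimeter P = length5 (P 0%nat) (P 1%nat) (P 2%nat) (P 3%nat) (P 4%nat).
Proof.
  reflexivity.
Qed.

Lemma signed_area_shoelace5 (P : nat -> point) :
  signed_area P = / 2 * shoelace5 (P 0%nat) (P 1%nat) (P 2%nat) (P 3%nat) (P 4%nat).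
Proof.
  reflexivity.
Qed.

Lemma pentagon_neq_prev (P : nat -> point) (i : nat) :
  pentagon P -> (i < 5)%nat -> P (prev i) <> P i.
Proof.
  intros [HP _] Hi.
  assert (Hp : (prev i < 5)%nat) by (apply Nat.mod_upper_bound; lia).
  replace (P i) with (P (next (prev i))) by
    (f_equal; destruct i as [|[|[|[|[|i]]]]]; try reflexivity; lia).
  apply HP, Hp.
Qed.

Lemma interior_angle_ccw (P : nat -> point) (i : nat) :
  0 < signed_area P ->
  interior_angle P i = ccw_angle (vsub (P (next i)) (P i)) (vsub (P (prev i)) (P i)).
Proof.
  intros H; unfold interior_angle; destruct (Rlt_dec 0 (signed_area P)); [reflexivity | lra].
Qed.

Lemma corner_of_interior_angle (P : nat -> point) (i : nat) :
  pentagon P -> 0 < signed_area P -> (i < 5)%nat -> 0 < interior_angle P i < PI ->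
  0 < turn (P (prev i)) (P i) (P (next i)) /\
  ext_half_tan (P (prev i)) (P i) (P (next i)) = tan ((PI - interior_angle P i) / 2).
Proof.
  intros HP HA Hi H; rewrite (interior_angle_ccw _ _ HA) in *.
  assert (T : 0 < turn (P (prev i)) (P i) (P (next i))).
  { apply turn_pos_of_ccw_angle; [apply HP, Hi | apply pentagon_neq_prev; assumption |].
    exact H. }
  split; [exact T |].
  rewrite (ext_half_tan_angle _ _ _ T), (ccw_angle_ext_angle _ _ _ T); f_equal; field.
Qed.

(** The exterior angles are [PI / 2] and [PI / 3], with half-angle tangents [tan (PI / 4)] and
    [tan (PI / 6)]. *)
Lemma cairo_corner (C : nat -> point) :
  cairo C -> 0 < signed_area C ->
  exists j k : nat, (j < 5)%nat /\ (k < 5)%nat /\ j <> k /\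
    forall i, (i < 5)%nat ->
      0 < turn (C (prev i)) (C i) (C (next i)) /\
      ext_half_tan (C (prev i)) (C i) (C (next i))
      = if orb (Nat.eqb i j) (Nat.eqb i k) then 1 else / sqrt 3.
Proof.
  intros (HP & _ & j & k & Hj & Hk & Hjk & _ & _ & Aj & Ak & Ai) HA.
  exists j, k; repeat (split; [assumption |]).
  intros i Hi; pose proof PI_RGT_0 as HPI.
  pose proof (corner_of_interior_angle C i HP HA Hi) as E.
  destruct (Nat.eqb_spec i j) as [-> | Nj]; [| destruct (Nat.eqb_spec i k) as [-> | Nk]];
    simpl.
  - rewrite Aj in E; destruct E as [E1 E2]; [lra | split; [exact E1 |]].
    rewrite E2; replace ((PI - PI / 2) / 2) with (PI / 4) by field; apply tan_PI4.
  - rewrite Ak in E; destruct E as [E1 E2]; [lra | split; [exact E1 |]].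
    rewrite E2; replace ((PI - PI / 2) / 2) with (PI / 4) by field; apply tan_PI4.
  - rewrite (Ai i Hi Nj Nk) in E; destruct E as [E1 E2]; [lra | split; [exact E1 |]].
    rewrite E2; replace ((PI - 2 * PI / 3) / 2) with (PI / 6) by field.
    rewrite tan_PI6; unfold Rdiv; ring.
Qed.

(** The half-angle tangents add up to [2 + 3 / sqrt 3 = 2 + sqrt 3] wherever the right angles sit,
    and the shoelace sum is 2. *)
Lemma cairo_perimeter_oriented (C : nat -> point) :
  cairo C -> signed_area C = 1 -> (perimeter C)^2 = 4 * (2 + sqrt 3).
Proof.
  intros HC HA.
  destruct (cairo_corner C HC) as (j & k & Hj & Hk & Hjk & E); [lra |].
  destruct HC as (_ & (c & r & Hr & T) & _).
  pose proof (fun i (Hi : (i < 5)%nat) => proj1 (E i Hi)) as E1.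
  pose proof (fun i (Hi : (i < 5)%nat) => proj2 (E i Hi)) as E2.
  assert (L0 : (0 < 5)%nat) by lia; assert (L1 : (1 < 5)%nat) by lia;
  assert (L2 : (2 < 5)%nat) by lia; assert (L3 : (3 < 5)%nat) by lia;
  assert (L4 : (4 < 5)%nat) by lia.
  rewrite signed_area_shoelace5 in HA; rewrite perimeter_length5.
  rewrite (circumscribed_length (C 0%nat) (C 1%nat) (C 2%nat) (C 3%nat) (C 4%nat) c r
    (conj (E1 _ L0) (conj (E1 _ L1) (conj (E1 _ L2) (conj (E1 _ L3) (E1 _ L4))))) Hr
    (T _ L0) (T _ L1) (T _ L2) (T _ L3) (T _ L4)).
  replace (shoelace5 _ _ _ _ _) with 2 by lra.
  assert (EK : half_tan_sum (C 0%nat) (C 1%nat) (C 2%nat) (C 3%nat) (C 4%nat)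
               = 2 + 3 * / sqrt 3).
  { pose proof (E2 _ L0) as K0; pose proof (E2 _ L1) as K1; pose proof (E2 _ L2) as K2;
    pose proof (E2 _ L3) as K3; pose proof (E2 _ L4) as K4.
    unfold half_tan_sum.
    change (ext_half_tan (C 4%nat) (C 0%nat) (C 1%nat)) with
      (ext_half_tan (C (prev 0)) (C 0%nat) (C (next 0))); rewrite K0.
    change (ext_half_tan (C 0%nat) (C 1%nat) (C 2%nat)) with
      (ext_half_tan (C (prev 1)) (C 1%nat) (C (next 1))); rewrite K1.
    change (ext_half_tan (C 1%nat) (C 2%nat) (C 3%nat)) with
      (ext_half_tan (C (prev 2)) (C 2%nat) (C (next 2))); rewrite K2.
    change (ext_half_tan (C 2%nat) (C 3%nat) (C 4%nat)) with
      (ext_half_tan (C (prev 3)) (C 3%nat) (C (next 3))); rewrite K3.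
    change (ext_half_tan (C 3%nat) (C 4%nat) (C 0%nat)) with
      (ext_half_tan (C (prev 4)) (C 4%nat) (C (next 4))); rewrite K4.
    clear - Hj Hk Hjk.
    destruct j as [|[|[|[|[|j]]]]]; try lia; destruct k as [|[|[|[|[|k]]]]]; try lia;
      simpl; ring. }
  rewrite EK.
  assert (S : 0 < sqrt 3) by (apply sqrt_lt_R0; lra).
  replace (3 * / sqrt 3) with (sqrt 3);
    [ring | apply Rmult_eq_reg_r with (sqrt 3); [| lra]].
  rewrite sqrt_sqrt by lra; field; lra.
Qed.

(** * Reversing the orientation *)

Definition mirror (p : point) : point := (fst p, - snd p).

Lemma on_segment_mirror (p q x : point) :
  on_segment p q x -> on_segment (mirror p) (mirror q) (mirror x).
Proof.
  intros (t & Ht & E); exists t; split; [exact Ht |].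
  rewrite E; unfold mirror; simpl; f_equal; ring.
Qed.

Lemma mirror_involutive (p : point) : mirror (mirror p) = p.
Proof.
  destruct p as [a b]; unfold mirror; simpl; f_equal; ring.
Qed.

Lemma point_dist_mirror (p q : point) :
  point_dist (mirror p) (mirror q) = point_dist p q.
Proof.
  unfold point_dist, norm; f_equal; unfold dot, vsub, mirror; simpl; ring.
Qed.

Lemma pentagon_mirror (P : nat -> point) :
  pentagon P -> pentagon (fun i => mirror (P i)).
Proof.
  intros [HN HS]; split.
  - intros i Hi E; apply (HN i Hi).
    rewrite <- (mirror_involutive (P i)), E; apply mirror_involutive.
  - intros i j x Hi Hj Hij S1 S2.
    apply on_segment_mirror in S1, S2; rewrite !mirror_involutive in S1, S2.
    destruct (HS i j _ Hi Hj Hij S1 S2) as [[A B] | [A B]]; [left | right];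
      (split; [exact A | rewrite <- B; symmetry; apply mirror_involutive]).
Qed.

Lemma perimeter_mirror (P : nat -> point) :
  perimeter (fun i => mirror (P i)) = perimeter P.
Proof.
  rewrite !perimeter_length5; unfold length5; rewrite !point_dist_mirror; reflexivity.
Qed.

Lemma signed_area_mirror (P : nat -> point) :
  signed_area (fun i => mirror (P i)) = - signed_area P.
Proof.
  rewrite !signed_area_shoelace5; unfold shoelace5, cross, mirror; simpl; ring.
Qed.

Lemma ccw_angle_mirror (p q r : point) :
  ccw_angle (vsub (mirror p) (mirror q)) (vsub (mirror r) (mirror q))
  = ccw_angle (vsub r q) (vsub p q).
Proof.
  pose proof (point_dist_mirror q p) as E1; pose proof (point_dist_mirror q r) as E2.
  unfold point_dist in E1, E2; unfold ccw_angle; rewrite E1, E2.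
  replace (cross (vsub (mirror p) (mirror q)) (vsub (mirror r) (mirror q)))
    with (cross (vsub r q) (vsub p q))
    by (unfold cross, vsub, mirror; simpl; ring).
  replace (dot (vsub (mirror p) (mirror q)) (vsub (mirror r) (mirror q)))
    with (dot (vsub r q) (vsub p q))
    by (unfold dot, vsub, mirror; simpl; ring).
  rewrite (Rmult_comm (norm (vsub p q))); reflexivity.
Qed.

(** Mirroring switches the branch of [interior_angle], which exchanges the arguments of [ccw_angle];
    by [ccw_angle_mirror] the reflection exchanges them back. *)
Lemma interior_angle_mirror (P : nat -> point) (i : nat) :
  signed_area P <> 0 ->
  interior_angle (fun i => mirror (P i)) i = interior_angle P i.
Proof.
  intros H; unfold interior_angle; rewrite signed_area_mirror, !ccw_angle_mirror.
  destruct (Rlt_dec 0 (- signed_area P)), (Rlt_dec 0 (signed_area P)); lra || reflexivity.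
Qed.

Lemma cairo_mirror (C : nat -> point) :
  signed_area C <> 0 -> cairo C -> cairo (fun i => mirror (C i)).
Proof.
  intros HA (HP & (c & r & Hr & T) & j & k & Hj & Hk & Hjk & N1 & N2 & Aj & Ak & Ai).
  split; [apply pentagon_mirror; exact HP | split].
  - exists (mirror c), r; split; [exact Hr |].
    intros i Hi; destruct (T i Hi) as (x & S & D & O).
    exists (mirror x); split; [apply on_segment_mirror; exact S | split].
    + rewrite point_dist_mirror; exact D.
    + rewrite <- O; unfold dot, vsub, mirror; simpl; ring.
  - exists j, k; rewrite !interior_angle_mirror by exact HA.
    repeat (split; [assumption |]).
    intros i Hi Hij Hik; rewrite interior_angle_mirror by exact HA; auto.
Qed.

Lemma area_1_cases (P : nat -> point) :
  area P = 1 -> signed_area P = 1 \/ signed_area (fun i => mirror (P i)) = 1.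
Proof.
  unfold area; rewrite signed_area_mirror; intros H.
  unfold Rabs in H; destruct (Rcase_abs (signed_area P)); [right | left]; lra.
Qed.

Lemma cairo_perimeter (C : nat -> point) :
  cairo C -> area C = 1 -> (perimeter C)^2 = 4 * (2 + sqrt 3).
Proof.
  intros HC HA; destruct (area_1_cases C HA) as [H | H].
  - apply cairo_perimeter_oriented; assumption.
  - rewrite <- perimeter_mirror; apply cairo_perimeter_oriented; [| exact H].
    apply cairo_mirror; [rewrite signed_area_mirror in H; lra | exact HC].
Qed.

(** * Interior angles of efficient pentagons *)

Lemma pentagon_disjoint_sides (P : nat -> point) (i j : nat) :
  pentagon P -> (i < 5)%nat -> (j < 5)%nat -> i <> j -> j <> next i -> i <> next j ->
  disjoint_segments (P i) (P (next i)) (P j) (P (next j)).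
Proof.
  intros [_ HS] Hi Hj Hij Nj Ni x S1 S2.
  destruct (HS i j x Hi Hj Hij S1 S2) as [[A _] | [A _]]; contradiction.
Qed.

Lemma pentagon_simple5 (P : nat -> point) :
  pentagon P -> simple5 (P 0%nat) (P 1%nat) (P 2%nat) (P 3%nat) (P 4%nat).
Proof.
  intros HP; repeat split.
  - apply (pentagon_disjoint_sides P 0 2 HP); cbv; lia.
  - apply (pentagon_disjoint_sides P 1 3 HP); cbv; lia.
  - apply (pentagon_disjoint_sides P 2 4 HP); cbv; lia.
  - apply (pentagon_disjoint_sides P 3 0 HP); cbv; lia.
  - apply (pentagon_disjoint_sides P 4 1 HP); cbv; lia.
Qed.

(** [efficient_corner_bounds] concerns the first of five points, so the vertices are rotated until
    vertex [i] comes first. *)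
Lemma interior_angle_bounds_oriented (P : nat -> point) (i : nat) :
  pentagon P -> signed_area P = 1 -> (perimeter P)^2 <= 4 * (2 + sqrt 3) ->
  (i < 5)%nat ->
  degrees 80.91 < interior_angle P i < degrees 142.29.
Proof.
  intros HP HA HL Hi; rewrite interior_angle_ccw by lra.
  rewrite perimeter_length5 in HL; rewrite signed_area_shoelace5 in HA.
  pose proof (pentagon_simple5 P HP) as S0.
  pose proof (simple5_rot _ _ _ _ _ S0) as S1.
  pose proof (simple5_rot _ _ _ _ _ S1) as S2.
  pose proof (simple5_rot _ _ _ _ _ S2) as S3.
  pose proof (simple5_rot _ _ _ _ _ S3) as S4.
  destruct i as [|[|[|[|[|i]]]]]; [| | | | | lia];
    [apply efficient_corner_bounds in S0; [exact S0 | |]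
    |apply efficient_corner_bounds in S1; [exact S1 | |]
    |apply efficient_corner_bounds in S2; [exact S2 | |]
    |apply efficient_corner_bounds in S3; [exact S3 | |]
    |apply efficient_corner_bounds in S4; [exact S4 | |]];
    unfold length5, shoelace5 in *; lra.
Qed.

Theorem proposition2p15 (P : nat -> point) (i : nat)
    (hP : efficient P) (hi : (i < 5)%nat) :
  degrees 80.91 < interior_angle P i < degrees 142.29.
Proof.
  destruct hP as (HP & HA & C & HC & AC & HL).
  assert (HL2 : (perimeter P)^2 <= 4 * (2 + sqrt 3)).
  { rewrite <- (cairo_perimeter C HC AC); apply pow_incr; split; [| exact HL].
    rewrite perimeter_length5; unfold length5, point_dist.
    repeat apply Rplus_le_le_0_compat; apply norm_ge0. }
  destruct (area_1_cases P HA) as [H | H].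
  - apply interior_angle_bounds_oriented; assumption.
  - rewrite <- interior_angle_mirror by (rewrite signed_area_mirror in H; lra).
    apply interior_angle_bounds_oriented; try assumption.
    + apply pentagon_mirror; exact HP.
    + rewrite perimeter_mirror; exact HL2.
Qed.
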